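(* Let $q$ be a complex number with $0<|q|<1$. For integers $m\ge 1$ and $0\le a\le m$ define $$\mathscr{S}_{m,a}=\sum_{n_m,\dots,n_1\ge 0}\frac{q^{n_m^2+\cdots+n_1^2}}{(q^2;q^2)_{n_m}}\prod_{i=1}^{m-1}\begin{bmatrix} n_{i+1}+\delta_{a,i}\\ n_i\end{bmatrix}_{q^2}.$$ Then for $1\le a\le m$ we have $$\mathscr{S}_{m,a}-\mathscr{S}_{m,a-1}=q^{a}\,\frac{(-q;q^2)_\infty}{(q^2;q^2)_\infty}\,(q^{m+1-2a},q^{m+3+2a},q^{2m+4};q^{2m+4})_\infty.$$
   Context: Notation: $(x;p)_n=\prod_{j=0}^{n-1}(1-xp^j)$ for $n\ge 0$, $(x;p)_\infty=\prod_{j\ge 0}(1-xp^j)$, and $(x_1,\dots,x_k;p)_\infty=\prod_{i=1}^k(x_i;p)_\infty$. The $q^2$-binomial coefficient is $\begin{bmatrix} n\\k\end{bmatrix}_{q^2}=\frac{(q^2;q^2)_n}{(q^2;q^2)_{n-k}(q^2;q^2)_k}$ if $0\le k\le n$, and $0$ otherwise. $\delta_{i,j}$ is the Kronecker delta; empty products equal $1$. *)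

(* Defs.v *)
From mathcomp Require Import all_boot all_order all_algebra.
From mathcomp Require Import finmap complex.
From mathcomp Require Import all_classical all_reals all_analysis.
From mathcomp Require Import showcase.summability.

Set Implicit Arguments.
Unset Strict Implicit.
Unset Printing Implicit Defensive.

Import Order.TTheory GRing.Theory Num.Theory.
Import numFieldNormedType.Exports.

Local Open Scope classical_set_scope.
Local Open Scope ring_scope.

Definition qpoch (K : fieldType) (x p : K) (n : nat) : K :=
  \prod_(0 <= j < n) (1 - x * p ^+ j).

(* A limit in the norm topology of K; it exists in C whenever |p| < 1. *)
Definition qpoch_inf (K : numFieldType) (x p : K) : K :=
  lim (qpoch x p @ \oo).

Definition qpoch_infs (K : numFieldType) (xs : seq K) (p : K) : K :=
  \prod_(x <- xs) qpoch_inf x p.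

(* The binomial coefficient in base p (the q^2-binomial is p = q ^+ 2). *)
Definition qbinom (K : fieldType) (p : K) (n k : nat) : K :=
  if (k <= n)%N then qpoch p p n / (qpoch p p (n - k) * qpoch p p k) else 0.

(* The summation variables (n_1, ..., n_m) form a tuple n indexed from 0:
   n_i is its entry i.-1, and n_(i+1) its entry i. *)
Definition S_term (K : fieldType) (q : K) (m a : nat) (n : m.-tuple nat) : K :=
  q ^+ (\sum_(1 <= i < m.+1) nth 0%N n i.-1 ^ 2)
    / qpoch (q ^+ 2) (q ^+ 2) (nth 0%N n m.-1)
  * \prod_(1 <= i < m)
      qbinom (q ^+ 2) (nth 0%N n i + (a == i)) (nth 0%N n i.-1).

(* Unconditional convergence: the finite partial sums converge along the
   directed set of finite subsets of nat^m, as in the definition of sum. *)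
Definition S_converges (K : numFieldType) (q : K) (m a : nat) : Prop :=
  cvg (partial_sum (@S_term K q m a) @ totally).

Definition S_sum (K : numFieldType) (q : K) (m a : nat) : K :=
  sum (@S_term K q m a).

(* Main.v *)
(* Write [p = q^2], let [S_fin q a m L] be the finite sum obtained by adding the
   variable [n_(m+1) = L] and the factor [[L + delta_(a,m); n_m]] in place of
   [1/(p;p)_(n_m)]; it tends to [S_(m,a)] as [L] tends to infinity. For
   [B_L(r) = (-q;p)_L (p;p)_L / ((p;p)_(L-r) (p;p)_(L+r))], the q-Vandermonde
   sum gives Bailey's lemma [sum_s [L;s] q^(s^2) B_s(r) = q^(r^2) B_L(r)], so that
   summing over one more [n_i] multiplies the coefficient of [B(r)] by
   [q^(r^2)]; the recursion starts from [1 = sum_r (-1)^r q^(2r^2-r) B_L(r)]. The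
   shift [delta_(a,i)] replaces [L] by [L+1] once, at level [a]; the reflection
   [r -> 1-r] shows that its effect is to multiply the coefficient
   [(-1)^r q^((a+2)r^2-r)] by [sum_(i <= a) q^(i(1-2r))]. Hence only the term
   [i = a] survives in [S_(m,a) - S_(m,a-1)], and letting [L] tend to infinity
   termwise leaves a theta series, summed by the Jacobi triple product. *)
Require Import Defs.
From mathcomp Require Import all_boot all_order all_algebra.
From mathcomp Require Import finmap complex.
From mathcomp Require Import all_classical all_reals all_analysis.
From mathcomp Require Import showcase.summability.
From mathcomp Require Import ring lra zify.

Set Implicit Arguments.
Unset Strict Implicit.
Unset Printing Implicit Defensive.

Import Order.TTheory GRing.Theory Num.Theory.
Import numFieldNormedType.Exports.

Local Open Scope ring_scope.

(** * Finite identities *)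

Section QPochhammer.
Variable K : fieldType.
Implicit Types x p a d z Q : K.

Lemma qpoch0 x p : qpoch x p 0 = 1.
Proof. by rewrite /qpoch big_nil. Qed.

Lemma qpochS x p n : qpoch x p n.+1 = qpoch x p n * (1 - x * p ^+ n).
Proof. by rewrite /qpoch big_nat_recr. Qed.

Lemma qpochD x p m n :
  qpoch x p (m + n) = qpoch x p m * qpoch (x * p ^+ m) p n.
Proof.
elim: n => [|n IHn]; first by rewrite addn0 qpoch0 mulr1.
by rewrite addnS !qpochS IHn exprD !mulrA.
Qed.

Lemma qpochSl x p n : qpoch x p n.+1 = (1 - x) * qpoch (x * p) p n.
Proof. by rewrite -add1n qpochD qpochS qpoch0 mul1r mulr1 expr1. Qed.

Lemma qpoch_neq0 p n : (forall j, p ^+ j.+1 != 1) -> qpoch p p n != 0.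
Proof.
move=> p1; elim: n => [|n IHn]; first by rewrite qpoch0 oner_neq0.
by rewrite qpochS mulf_neq0 // -exprS subr_eq0 eq_sym.
Qed.

Lemma qbinom0 p n : (forall j, p ^+ j.+1 != 1) -> qbinom p n 0 = 1.
Proof.
by move=> p1; rewrite /qbinom leq0n subn0 qpoch0 mulr1 divff // qpoch_neq0.
Qed.

Lemma qbinom_small p n k : (n < k)%N -> qbinom p n k = 0.
Proof. by rewrite /qbinom ltnNge => /negPf ->. Qed.

Lemma qbinomS p n k : (forall j, p ^+ j.+1 != 1) ->
  qbinom p n.+1 k.+1 = qbinom p n k.+1 + p ^+ (n - k) * qbinom p n k.
Proof.
move=> p1; have P0 j := @qpoch_neq0 p j p1.
case: (ltngtP n k) => [ltnk|ltkn|->].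
- by rewrite !qbinom_small ?mulr0 ?addr0 // ltnW.
- rewrite /qbinom ltnS ltkn (ltnW ltkn) subSS.
  have [e ->] : exists e, n = (k + e.+1)%N by exists (n - k.+1)%N; lia.
  have -> : ((k + e.+1) - k = e.+1)%N by lia.
  have -> : ((k + e.+1) - k.+1 = e)%N by lia.
  have := P0 e.+1; have := P0 k.+1.
  rewrite !qpochS !mulf_eq0 !negb_or => /andP[_ k1] /andP[_ e1].
  rewrite exprD exprS.
  by field; rewrite k1 e1 !P0.
- rewrite (@qbinom_small _ k k.+1) // add0r subnn expr0 mul1r /qbinom !leqnn.
  by rewrite !subnn !qpoch0 !mul1r !divff.
Qed.

(** The q-Chu-Vandermonde sum with denominators cleared. Induction on [M]: the q-Pascal rule splits
    the sum into the sums for [M] with parameters [a] and [a * p], and (1 - a d p^M) - d p^M (1 - a)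
    = 1 - d p^M. *)
Lemma q_vandermonde p d M a : (forall j, p ^+ j.+1 != 1) ->
  \sum_(0 <= t < M.+1) qbinom p M t * (- d) ^+ t * p ^+ 'C(t, 2) *
    qpoch a p t * qpoch (a * d * p ^+ t) p (M - t) = qpoch d p M.
Proof.
move=> p1; elim: M a => [|M IHM] a.
  by rewrite big_nat1 qbinom0 // !qpoch0 !expr0 !mulr1.
pose X a M t := (- d) ^+ t * p ^+ 'C(t, 2) * qpoch a p t *
   qpoch (a * d * p ^+ t) p (M - t).
have IH b : \sum_(0 <= t < M.+1) qbinom p M t * X b M t = qpoch d p M.
  by rewrite -(IHM b); apply: eq_bigr => t _; rewrite /X !mulrA.
transitivity (\sum_(0 <= t < M.+2) qbinom p M.+1 t * X a M.+1 t).
  by apply: eq_bigr => t _; rewrite /X !mulrA.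
rewrite big_nat_recl //.
under eq_bigr => t _ do rewrite qbinomS // mulrDl.
rewrite big_split /= addrA qbinom0 // -(qbinom0 M p1).
rewrite -(@big_nat_recl _ _ _ _ 0 (fun t => qbinom p M t * X a M.+1 t)) //.
rewrite big_nat_recr //= (@qbinom_small _ M M.+1) // mul0r addr0.
have -> : \sum_(0 <= t < M.+1) qbinom p M t * X a M.+1 t =
    (1 - a * d * p ^+ M) * qpoch d p M.
  rewrite -(IH a) big_distrr /= !big_nat; apply: eq_bigr => t /andP[_ tM].
  by rewrite /X subSn // qpochS -[X in 1 - X]mulrA -exprD subnKC //; ring.
have -> : \sum_(0 <= i < M.+1) p ^+ (M - i) * qbinom p M i * X a M.+1 i.+1 =
   - d * p ^+ M * (1 - a) * qpoch d p M.
  rewrite -(IH (a * p)) big_distrr /= !big_nat; apply: eq_bigr => t /andP[_ tM].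
  rewrite /X subSS qpochSl binS bin1 exprD !exprS.
  have -> : p ^+ M = p ^+ (M - t) * p ^+ t by rewrite -exprD subnK.
  have -> : a * d * (p * p ^+ t) = a * p * d * p ^+ t by ring.
  by ring.
by rewrite qpochS; ring.
Qed.

Lemma q_binomial p d M : (forall j, p ^+ j.+1 != 1) ->
  \sum_(0 <= t < M.+1) qbinom p M t * (- d) ^+ t * p ^+ 'C(t, 2) = qpoch d p M.
Proof.
move=> p1; rewrite -(q_vandermonde d M 0 p1); apply: eq_bigr => t _.
by rewrite !mul0r /qpoch !big1 ?mulr1 // => i _; rewrite mul0r subr0.
Qed.

Lemma expr2_bin2 x n : (x ^+ 2) ^+ 'C(n, 2) * x ^+ n = x ^+ (n ^ 2).
Proof.
rewrite -exprM -exprD; congr (_ ^+ _).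
by rewrite bin2 mul2n halfK oddM; case: n => // n; rewrite /= expnS expn1; lia.
Qed.

End QPochhammer.

(** Serves both to change the window of a bilateral sum and to reindex it by a reflection, which
    need not preserve the window. *)
Lemma big_supp (V : nmodType) (I : eqType) (s t : seq I) (F : I -> V) :
    uniq s -> uniq t ->
    (forall x, x \in s -> x \notin t -> F x = 0) ->
    (forall x, x \in t -> x \notin s -> F x = 0) ->
  \sum_(x <- s) F x = \sum_(x <- t) F x.
Proof.
move=> us ut st ts.
rewrite (bigID (mem t)) [RHS](bigID (mem s)) /=.
rewrite [X in _ + X]big1_seq => [|x /andP[/[swap] xs]]; last exact: st.
rewrite [X in _ = _ + X]big1_seq => [|x /andP[/[swap] xs]]; last exact: ts.
rewrite -big_filter -[in RHS]big_filter; congr (_ + _); apply: perm_big.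
apply: uniq_perm; rewrite ?filter_uniq // => x.
by rewrite !mem_filter andbC.
Qed.

Definition zwin (N : nat) : seq int :=
  [seq j%:Z - N%:Z | j <- iota 0 (2 * N).+1].

Lemma big_zwin (V : nmodType) N (F : int -> V) :
  \sum_(r <- zwin N) F r = \sum_(0 <= j < (2 * N).+1) F (j%:Z - N%:Z).
Proof. by rewrite big_map /index_iota subn0. Qed.

Lemma zwin_uniq N : uniq (zwin N).
Proof.
by rewrite map_inj_uniq ?iota_uniq // => i j /addIr[].
Qed.

Lemma mem_zwin N (r : int) : (r \in zwin N) = (`|r| <= N)%N.
Proof.
apply/mapP/idP => [[j]|rN]; first by rewrite mem_iota => /andP[_ jN] ->; lia.
by exists (absz (r + N%:Z)); [rewrite mem_iota; lia | lia].
Qed.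

(** * The finite form of the Jacobi triple product *)

Section FiniteTripleProduct.
Variable K : fieldType.

Lemma sqr_order (Q : K) : (forall n, Q ^+ n.+1 != 1) ->
  forall n, (Q ^+ 2) ^+ n.+1 != 1.
Proof. by move=> Q1 n; rewrite -exprM mulnS add2n. Qed.

Lemma sign_absz (r : int) : (-1) ^ r = (-1) ^+ absz r :> K.
Proof. by case: r => n //; rewrite NegzE abszN -exprz_inv invrN1. Qed.

(** The central binomial [2N; N+r] in base [P], written with [absz r] so that its symmetry in r is
    immediate. *)
Definition cbin (P : K) (N : nat) (r : int) : K :=
  if (absz r <= N)%N
  then qpoch P P (2 * N) / (qpoch P P (N - absz r) * qpoch P P (N + absz r))
  else 0.

Lemma cbinE (P : K) N j : (j <= 2 * N)%N ->
  cbin P N (j%:Z - N%:Z) = qbinom P (2 * N) j.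
Proof.
move=> jN; rewrite /cbin /qbinom jN; have [Nj|jN'] := leqP N j.
  have -> : (`|j%:Z - N%:Z|%N = j - N)%N by lia.
  have -> : (j - N <= N)%N by lia.
  have -> : (N - (j - N) = 2 * N - j)%N by lia.
  by have -> : (N + (j - N) = j)%N by lia.
have -> : (`|j%:Z - N%:Z|%N = N - j)%N by lia.
rewrite leq_subr.
have -> : (N - (N - j) = j)%N by lia.
have -> : (N + (N - j) = 2 * N - j)%N by lia.
by rewrite [X in _ / X]mulrC.
Qed.

(** Each factor 1 - z Q^(-k) equals -z Q^(-k) (1 - Q^k / z), and the exponents k = 1, 3, ..., 2N-1
    add up to N^2. *)
Lemma qpoch_rev (Q z : K) N : Q != 0 -> z != 0 ->
  qpoch (z * Q ^ (1 - (2 * N)%:Z)) (Q ^+ 2) N * Q ^+ (N ^ 2) =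
  (- z) ^+ N * qpoch (Q / z) (Q ^+ 2) N.
Proof.
move=> Q0 z0; rewrite /qpoch big_nat_rev /=.
have -> : Q ^+ (N ^ 2) = \prod_(0 <= i < N) (Q * Q ^+ (2 * i)).
  elim: N => [|N IHN]; first by rewrite big_nil.
  by rewrite big_nat_recr //= -IHN -exprS -exprD; congr (_ ^+ _); lia.
have -> : (- z) ^+ N = \prod_(0 <= i < N) (- z).
  by rewrite prodr_const_nat subn0.
rewrite -!big_split /= !big_nat; apply: eq_bigr => i /andP[_ iN].
rewrite add0n -!exprM.
have -> : Q ^+ (2 * (N - i.+1)) = Q ^ ((2 * N)%:Z - 1) / (Q * Q ^+ (2 * i)).
  apply: (canRL (mulfK _)); first by rewrite mulf_neq0 ?expf_neq0.
  by rewrite -exprS !exprnP -expfzDr //; congr (_ ^ _); lia.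
have -> : Q ^ ((2 * N)%:Z - 1) = (Q ^ (1 - (2 * N)%:Z))^-1.
  by rewrite -opprB invr_expz.
have := expfz_neq0 (1 - (2 * N)%:Z) Q0; have := expf_neq0 (2 * i) Q0.
set A := Q ^ _; set C := Q ^+ _ => C0 A0.
by field; rewrite Q0 z0 A0 C0.
Qed.

(** The q-binomial theorem for (d; Q^2)_(2N) with d = z Q^(1-2N): the last N factors form (zQ;
    Q^2)_N, and the first N, reversed, give (Q/z; Q^2)_N. The summation index is shifted by N. *)
Lemma finite_triple_product (Q z : K) N : Q != 0 -> z != 0 ->
    (forall n, Q ^+ n.+1 != 1) ->
  \sum_(r <- zwin N) (-1) ^ r * Q ^ (r * r) * z ^ r * cbin (Q ^+ 2) N r =
  qpoch (z * Q) (Q ^+ 2) N * qpoch (Q / z) (Q ^+ 2) N.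
Proof.
move=> Q0 z0 Q1; set d := z * Q ^ (1 - (2 * N)%:Z).
have QN0 : (- z) ^+ N != 0 by rewrite expf_neq0 // oppr_eq0.
apply: (mulfI QN0); rewrite mulrCA -qpoch_rev // -/d.
have -> : z * Q = d * (Q ^+ 2) ^+ N.
  rewrite /d -mulrA -exprM exprnP -expfzDr // -[Q in LHS]expr1z.
  by congr (_ * _ ^ _); lia.
rewrite mulrA [X in _ = X * _]mulrC -qpochD addnn -mul2n.
rewrite -(q_binomial d _ (sqr_order Q1)) big_zwin.
rewrite big_distrr big_distrl /= !big_nat.
apply: eq_bigr => j /andP[_ jN]; rewrite cbinE //.
(* The powers of [Q] agree because (j - N)^2 = (1 - 2N) j + (j^2 - j) + N^2. *)
suff E : (- z) ^+ N * ((-1) ^ (j%:Z - N%:Z) *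
      Q ^ ((j%:Z - N%:Z) * (j%:Z - N%:Z)) * z ^ (j%:Z - N%:Z)) =
    (- d) ^+ j * (Q ^+ 2) ^+ 'C(j, 2) * Q ^+ (N ^ 2).
  by rewrite mulrA E; ring.
have := expr2_bin2 Q j; move/(canRL (mulfK (expf_neq0 _ Q0))) => ->.
rewrite /d -mulNr exprMn !exprnP exprz_exp.
have -> : - z = (-1) * z by rewrite mulN1r.
rewrite !exprzMl ?unitfE ?oppr_eq0 ?oner_eq0 //.
have E (x : K) : x != 0 -> x ^ (j%:Z - N%:Z) * x ^ N%:Z = x ^ j%:Z.
  by move=> x0; rewrite -expfzDr // subrK.
rewrite -(E z z0) -(E (-1)) ?oppr_eq0 ?oner_eq0 //.
have -> : Q ^ ((j%:Z - N%:Z) * (j%:Z - N%:Z)) =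
    Q ^ ((1 - (2 * N)%:Z) * j) * (Q ^ (j ^ 2)%:Z / Q ^ j) * Q ^ (N ^ 2)%:Z.
  by rewrite invr_expz -!expfzDr //; congr (_ ^ _); lia.
by ring.
Qed.

End FiniteTripleProduct.

(** * Bailey's lemma and the unit Bailey pair *)

Section BaileyPair.
Variables (K : numFieldType) (q : K).
Local Notation p := (q ^+ 2).

(** Going through [cbin] makes the finite triple product directly applicable and builds in the
    vanishing for |r| > L. *)
Definition bailey (L : nat) (r : int) : K :=
  qpoch (- q) p L * qpoch p p L / qpoch p p (2 * L) * cbin p L r.

Lemma bailey_small L r : (L < absz r)%N -> bailey L r = 0.
Proof. by rewrite /bailey /cbin ltnNge => /negPf ->; rewrite mulr0. Qed.

Lemma baileyN L r : bailey L (- r) = bailey L r.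
Proof. by rewrite /bailey /cbin abszN. Qed.

Lemma sum_bailey_window (alpha : int -> K) L N N' :
    (L <= N)%N -> (L <= N')%N ->
  \sum_(r <- zwin N) alpha r * bailey L r =
  \sum_(r <- zwin N') alpha r * bailey L r.
Proof.
move=> LN LN'; apply: big_supp; rewrite ?zwin_uniq // => r _.
  by rewrite mem_zwin -ltnNge => Nr; rewrite bailey_small ?mulr0 //; lia.
by rewrite mem_zwin -ltnNge => Nr; rewrite bailey_small ?mulr0 //; lia.
Qed.

Hypotheses (q0 : q != 0) (q1 : forall n, q ^+ n.+1 != 1).

Let p1 : forall n, p ^+ n.+1 != 1. Proof. exact: sqr_order. Qed.
Let P0 n : qpoch p p n != 0. Proof. exact: qpoch_neq0. Qed.

Lemma baileyE L r : (absz r <= L)%N -> bailey L r =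
  qpoch (- q) p L * qpoch p p L /
    (qpoch p p (L - absz r) * qpoch p p (L + absz r)).
Proof. by move=> rL; rewrite /bailey /cbin rL; field; rewrite !P0. Qed.

(** Only s >= |r| contributes. With k = |r|, s = k + t and M = L - k, this is the q-Vandermonde sum
    with both parameters equal to c = -q p^k. *)
Lemma bailey_step L r :
  \sum_(0 <= s < L.+1) qbinom p L s * q ^+ (s ^ 2) * bailey s r =
  q ^+ (absz r ^ 2) * bailey L r.
Proof.
have [rL|Lr] := leqP (absz r) L; last first.
  rewrite bailey_small // mulr0 big_nat big1 // => s /andP[_ sL].
  by rewrite bailey_small ?mulr0 //; lia.
rewrite (big_cat_nat (n := absz r)) //=; last exact: leqW.
rewrite big_nat big1 ?add0r => [|s /andP[_ sr]]; last first.
  by rewrite bailey_small ?mulr0.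
rewrite -{1}[absz r]add0n big_addn subSn //.
set k := absz r; set M := (L - k)%N.
have LE : L = (k + M)%N by rewrite /M subnKC.
set c := - q * p ^+ k.
transitivity (q ^+ (k ^ 2) * qpoch (- q) p k * qpoch p p L /
    (qpoch p p M * qpoch p p (k + L)) *
  \sum_(0 <= t < M.+1) qbinom p M t * (- c) ^+ t * p ^+ 'C(t, 2) *
    qpoch c p t * qpoch (c * c * p ^+ t) p (M - t)); last first.
  rewrite q_vandermonde // baileyE // -/k LE [qpoch (- q) _ (k + _)]qpochD -/c.
  have -> : (k + M - k = M)%N by lia.
  have -> : (k + (k + M) = k + M + k)%N by lia.
  by field; rewrite !P0.
rewrite big_distrr /= !big_nat; apply: eq_bigr => t /andP[_ tM].
rewrite baileyE -/k; last by lia.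
rewrite /qbinom; have -> : (t + k <= L)%N by lia.
rewrite -ltnS tM.
have -> : (L - (t + k) = M - t)%N by lia.
have -> : (t + k - k = t)%N by lia.
have -> : (k + L = (t + k + k) + (M - t))%N by lia.
rewrite -/(qpoch p p) [(t + k)%N]addnC [qpoch (- q) _ (k + _)]qpochD -/c.
rewrite [qpoch p p (k + t + k + (M - t))]qpochD.
(* So (c c p^t; p)_(M-t) is the tail that completes (p; p)_(2k+t) to (p; p)_(k+L). *)
have -> : c * c * p ^+ t = p * p ^+ (k + t + k).
  by rewrite /c !exprD; ring.
have -> : q ^+ ((k + t) ^ 2) = q ^+ (k ^ 2) * ((- c) ^+ t * p ^+ 'C(t, 2)).
  rewrite /c mulNr opprK exprMn [RHS](_ : _ = q ^+ (k ^ 2) * (p ^+ k) ^+ t *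
    (p ^+ 'C(t, 2) * q ^+ t)); last by ring.
  rewrite expr2_bin2.
  by rewrite -!exprM -!exprD; congr (_ ^+ _); lia.
have P1 : qpoch (p * p ^+ (k + t + k)) p (M - t) != 0.
  have := P0 (k + t + k + (M - t)).
  by rewrite qpochD mulf_eq0 negb_or => /andP[].
by field; rewrite !P0 P1.
Qed.

Lemma sum_bailey_step (alpha : int -> K) (P : nat -> K) L N :
    (L <= N)%N ->
    (forall s, (s <= L)%N -> P s = \sum_(r <- zwin N) alpha r * bailey s r) ->
  \sum_(0 <= s < L.+1) qbinom p L s * q ^+ (s ^ 2) * P s =
  \sum_(r <- zwin N) alpha r * q ^ (r * r) * bailey L r.
Proof.
move=> LN PE; rewrite big_nat.
under eq_bigr => s /andP[_ sL] do rewrite PE // big_distrr.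
rewrite -big_nat exchange_big; apply: eq_bigr => r _ /=.
have -> : r * r = (absz r ^ 2)%:Z by lia.
rewrite -mulrA -bailey_step big_distrr /=; apply: eq_bigr => s _.
by rewrite mulrCA.
Qed.

(** The finite triple product at z = 1/q: its factor (zq; p)_L = (1; p)_L vanishes unless L = 0. *)
Lemma unit_bailey L : 
  \sum_(r <- zwin L) (-1) ^ r * q ^ (r * r - r) * bailey L r = (L == 0)%:R.
Proof.
have qV0 : q^-1 != 0 by rewrite invr_eq0.
have := finite_triple_product L q0 qV0 q1; rewrite mulVf //.
case: L => [|L].
  rewrite !qpoch0 mul1r => E; rewrite -[RHS]E; apply: eq_bigr => r _.
  rewrite /bailey muln0 !qpoch0 !mulr1 divr1 mul1r; congr (_ * _).
  by rewrite -mulrA exprz_inv -expfzDr.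
rewrite qpochSl subrr !mul0r => E.
transitivity (qpoch (- q) p L.+1 * qpoch p p L.+1 / qpoch p p (2 * L.+1) *
  \sum_(r <- zwin L.+1)
    (-1) ^ r * q ^ (r * r) * q^-1 ^ r * cbin p L.+1 r); last first.
  by rewrite E mulr0.
rewrite big_distrr /=; apply: eq_bigr => r _.
by rewrite /bailey exprz_inv expfzDr //; ring.
Qed.

(** One Bailey step applied to [unit_bailey]: the inner sums are Kronecker deltas, so only [L; 0] =
    1 is left. *)
Lemma one_bailey L N : (L <= N)%N ->
  \sum_(r <- zwin N) (-1) ^ r * q ^ (2 * (r * r) - r) * bailey L r = 1.
Proof.
move=> LN.
transitivity (\sum_(0 <= s < L.+1)
    qbinom p L s * q ^+ (s ^ 2) * ((s == 0)%:R : K)).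
  rewrite (@sum_bailey_step (fun r => (-1) ^ r * q ^ (r * r - r)) _ L N) //.
    apply: eq_bigr => r _; rewrite -[(-1) ^ r * _ * q ^ _]mulrA -expfzDr //.
    by congr (_ * _ ^ _ * _); lia.
  by move=> s sL; rewrite -unit_bailey (@sum_bailey_window _ s s N) //; lia.
rewrite big_nat_recl // big1 ?addr0 => [|i _]; last by rewrite mulr0.
by rewrite qbinom0 // !mulr1.
Qed.

End BaileyPair.

Lemma big_zwin_opp (V : nmodType) N (F : int -> V) :
  \sum_(r <- zwin N) F (- r) = \sum_(r <- zwin N) F r.
Proof.
rewrite -(big_map -%R xpredT F).
have u : uniq (map -%R (zwin N)).
  by rewrite (map_inj_uniq (@oppr_inj _)) zwin_uniq.
apply: big_supp; rewrite ?zwin_uniq //.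
- by move=> _ /mapP[r rN ->]; rewrite mem_zwin abszN -mem_zwin rN.
- move=> r rN /mapP[]; exists (- r); last by rewrite opprK.
  by rewrite mem_zwin abszN -mem_zwin.
Qed.

Lemma big_zwin_odd (V : numDomainType) N (F : int -> V) :
  (forall r, F (- r) = - F r) -> \sum_(r <- zwin N) F r = 0.
Proof.
move=> oddF; apply/eqP; rewrite -eqNr; apply/eqP.
by rewrite -sumrN -[RHS]big_zwin_opp; apply: eq_bigr => r _; rewrite oddF.
Qed.

(** * The effect of the shift on the Bailey coefficients *)

Section Shift.
Variables (K : numFieldType) (q : K).
Hypotheses (q0 : q != 0) (q1 : forall n, q ^+ n.+1 != 1).
Local Notation p := (q ^+ 2).

Let p1 : forall n, p ^+ n.+1 != 1. Proof. exact: sqr_order. Qed.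
Let P0 n : qpoch p p n != 0. Proof. exact: qpoch_neq0. Qed.
Let p0 : p != 0. Proof. exact: expf_neq0. Qed.

Definition theta_coef (m : nat) (r : int) : K :=
  (-1) ^ r * q ^ ((m.+2)%:Z * (r * r) - r).

Definition geom_coef (a : nat) (r : int) : K :=
  \sum_(i < a.+1) (q ^ (1 - 2 * r)) ^+ i.

Lemma theta_coefN m r : theta_coef m (- r) = theta_coef m r * p ^ r.
Proof.
rewrite /theta_coef !sign_absz abszN [q ^+ 2]exprnP exprz_exp.
rewrite -mulrA -expfzDr //.
by congr (_ * _ ^ _); lia.
Qed.

(** With y = q^(1-2r), the power y^(m+1) is the one in (1 - y^(m+1)) / (1 - y) = [geom_coef m r]; so
    [theta_coef] times [geom_coef] is a sum over r and its reflection, divided by 1 - y. *)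
Lemma theta_coef_reflect m r :
  theta_coef m (1 - r) = - theta_coef m r * (q ^ (1 - 2 * r)) ^+ m.+1.
Proof.
rewrite /theta_coef exprnP exprz_exp mulNr -mulrA -expfzDr //.
rewrite [(-1) ^ (1 - r)]expfzDr ?oppr_eq0 ?oner_eq0 // expr1z.
rewrite mulN1r mulNr !sign_absz abszN.
by congr (- (_ * _ ^ _)); lia.
Qed.

(** The factor common to B_(L+1)(r), B_L(r) and B_L(r-1). Each is [D L r] times a polynomial in p^r
    and p^(-r), also at the edge, where B_L vanishes but [D] does not. The shift thereby becomes an
    identity of rational functions. *)
Let D L r : K := if (absz r <= L.+1)%N
  then qpoch (- q) p L * qpoch p p L /
    (qpoch p p (L.+1 - absz r) * qpoch p p (L.+1 + absz r))
  else 0.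

Let DN L r : D L (- r) = D L r. Proof. by rewrite /D abszN. Qed.

Let bailey_S L r : bailey q L.+1 r =
  D L r * (1 + q * p ^+ L) * (1 - p * p ^+ L).
Proof.
rewrite /D; case: leqP => rL; last by rewrite bailey_small ?mul0r.
rewrite baileyE // [qpoch (- q) _ _]qpochS [qpoch p p L.+1]qpochS.
by field; rewrite !P0.
Qed.

Let bailey_D_nat L (n : nat) : bailey q L n =
  D L n * (1 - p * p ^+ L * p ^ n) * (1 - p * p ^+ L / p ^ n).
Proof.
rewrite /D absz_nat; case: (ltngtP n L.+1) => nL.
- rewrite baileyE // absz_nat subSn // addSn !qpochS.
  have E : p ^+ L = p ^+ (L - n) * p ^ n by rewrite -exprD subnK.
  have := P0 (L - n).+1; have := P0 (L + n).+1.
  rewrite !qpochS exprD E -[p ^+ n]/(p ^ n) => + +.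
  rewrite !mulf_eq0 !negb_or => /andP[a b] /andP[c d].
  by field; rewrite expfz_neq0 // b d !P0.
- by rewrite bailey_small ?absz_nat ?mul0r // ltnW.
- rewrite nL bailey_small ?absz_nat // -[p ^ L.+1]/(p ^+ L.+1) -exprS.
  by rewrite divff ?expf_neq0 // subrr mulr0.
Qed.

Let bailey_D L r : bailey q L r =
  D L r * (1 - p * p ^+ L * p ^ r) * (1 - p * p ^+ L / p ^ r).
Proof.
case: (intP r) => [|n|n]; rewrite ?bailey_D_nat //.
by rewrite baileyN DN bailey_D_nat -invr_expz invrK mulrAC.
Qed.

Let bailey_pred_D L r : bailey q L (r - 1) =
  D L r * (1 - p * p ^+ L * p ^ r) * (1 - p ^+ L * p ^ r).
Proof.
have [n [->|->]] : exists n : nat, r = n.+1%:Z \/ r = - n%:Z.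
  case: (intP r) => [|n|n]; first by exists 0%N; right.
    by exists n; left.
  by exists n.+1; right.
- have -> : n.+1%:Z - 1 = n%:Z by lia.
  rewrite /D absz_nat ltnS; case: leqP => nL; last first.
    by rewrite bailey_small ?mul0r.
  rewrite baileyE // absz_nat subSS addSn addnS !qpochS.
  have := P0 (L + n).+2; rewrite !qpochS !mulf_eq0 !negb_or.
  move=> /andP[/andP[a b]]; rewrite [p ^+ _.+1]exprS exprD => c.
  rewrite exprD in b; rewrite -[p ^ n.+1]/(p ^+ n.+1) ![p ^+ _.+1]exprS ?exprD.
  by field; rewrite !P0 b c.
- have -> : - n%:Z - 1 = - (n.+1)%:Z by lia.
  rewrite baileyN DN -invr_expz /D absz_nat -[p ^ n]/(p ^+ n).
  case: (ltngtP n L) => nL.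
  + rewrite (leqW (ltnW nL)) baileyE // absz_nat.
    have [e ->] : exists e, L = (n + e.+1)%N.
      by exists (L - n.+1)%N; rewrite addnS -addSn subnKC.
    have -> : (n + e.+1 - n.+1 = e)%N by lia.
    have -> : ((n + e.+1).+1 - n = e.+2)%N by lia.
    rewrite addSnnS.
    have := P0 e.+2; rewrite !qpochS !mulf_eq0 !negb_or.
    move=> /andP[/andP[a b]]; rewrite ![p ^+ _.+1]exprS exprD => c.
    rewrite ![p ^+ _.+1]exprS in b *.
    by field; rewrite !P0 b c expf_neq0.
  + rewrite bailey_small; last by rewrite absz_nat ltnW.
    case: (leqP n L.+1) => nL'; last by rewrite !mul0r.
    have -> : n = L.+1 by lia.
    by rewrite -exprS divff ?expf_neq0 // subrr mulr0 mul0r.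
  + by rewrite -nL bailey_small ?absz_nat // divff ?expf_neq0 // subrr mulr0.
Qed.

Let yE r : q ^ (1 - 2 * r) = q / p ^ r.
Proof.
rewrite expfzDr // expr1z invr_expz [q ^+ 2]exprnP exprz_exp.
by congr (_ * _ ^ _); lia.
Qed.

Let y_neq1 r : 1 - q / p ^ r != 0.
Proof.
rewrite -yE subr_eq0 eq_sym.
(* The exponent is odd, hence nonzero, and [q] is not a root of unity. *)
have : 1 - 2 * r != 0 by lia.
case: (intP (1 - 2 * r)) => [|n|n] // _; first exact: q1.
by rewrite -invr_expz invr_eq1; exact: q1.
Qed.

Let theta_geomE a r : theta_coef a r * geom_coef a r =
  (theta_coef a r + theta_coef a (1 - r)) / (1 - q / p ^ r).
Proof.
apply: (canRL (mulfK (y_neq1 r))); rewrite theta_coef_reflect yE.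
have := subrX1 (q / p ^ r) a.+1; rewrite /geom_coef yE => E.
rewrite mulNr -{2}[theta_coef a r]mulr1 -mulrBr -mulrA; congr (_ * _).
by rewrite -[RHS]opprB E; ring.
Qed.

Lemma bailey_shift a L N : (L < N)%N ->
  \sum_(r <- zwin N) theta_coef a r * bailey q L.+1 r =
  \sum_(r <- zwin N) theta_coef a r * geom_coef a r * bailey q L r.
Proof.
(* [theta_coef * geom_coef] is a geometric sum, which splits into a term in [r]
   and its reflection under [r -> 1-r]; [g] is the second one, reindexed. The two add
   up to the left-hand summand plus an odd function of [r]. *)
move=> LN; pose g r := theta_coef a r / (1 - p ^ r / q) * bailey q L (r - 1).
have yV r : 1 - p ^ r / q != 0.
  have := y_neq1 r; have u0 : p ^ r != 0 by exact: expfz_neq0.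
  have -> : 1 - p ^ r / q = - (1 - q / p ^ r) * (p ^ r / q).
    by field; rewrite q0 u0.
  by rewrite !mulf_neq0 ?oppr_eq0 ?invr_eq0 // y_neq1.
have -> : \sum_(r <- zwin N) theta_coef a r * geom_coef a r * bailey q L r =
    \sum_(r <- zwin N) theta_coef a r / (1 - q / p ^ r) * bailey q L r +
    \sum_(r <- zwin N) g r.
  (* The reflection moves the window from [-N, N] to [1-N, N+1]; at the points -N and N+1 where
     these differ, B_L(r-1) vanishes because L < N. *)
  have -> : \sum_(r <- zwin N) g r = \sum_(r <- zwin N) g (1 - r).
    rewrite -(big_map (fun r => 1 - r) xpredT g).
    have u : uniq (map (fun r : int => 1 - r) (zwin N)).
      by rewrite map_inj_uniq ?zwin_uniq // => i j /addrI /oppr_inj.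
    apply: big_supp; rewrite ?zwin_uniq // => r.
      rewrite mem_zwin => rN /mapP rN'; rewrite /g bailey_small ?mulr0 //.
      rewrite ltnNge; apply/negP => rL; apply: rN'; exists (1 - r); last by lia.
      by rewrite mem_zwin; lia.
    move=> _; rewrite mem_zwin => rN.
    by rewrite /g bailey_small ?mulr0 //; lia.
  rewrite -big_split; apply: eq_bigr => r _ /=.
  rewrite theta_geomE mulrDl mulrDl; congr (_ + _); rewrite /g.
  rewrite -[bailey q L (1 - r - 1)]baileyN; have -> : - (1 - r - 1) = r by lia.
  congr (_ / (1 - _) * _).
  rewrite expfzDr // expr1z -invr_expz.
  have u0 : p ^ r != 0 by exact: expfz_neq0.
  by field; rewrite q0 u0.
apply/eqP; rewrite -subr_eq0 -big_split -sumrB /=; apply/eqP.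
(* The remaining summand is odd: [theta_coef] gains the factor p^r under r -> -r, which turns 1 -
   p^(-r) into -(1 - p^r), and [D] is even. *)
transitivity (\sum_(r <- zwin N) - (p * p ^+ L * (1 + q * p ^+ L)) *
    (theta_coef a r * (1 - p ^ r) * D L r)); last first.
  rewrite -big_distrr /= big_zwin_odd ?mulr0 // => r.
  rewrite theta_coefN DN -invr_expz.
  have u0 : p ^ r != 0 by exact: expfz_neq0.
  by field.
apply: eq_bigr => r _; rewrite /g bailey_S bailey_D bailey_pred_D.
have := yV r; have := y_neq1 r.
have u0 : p ^ r != 0 by exact: expfz_neq0.
set u := p ^ r; set Y := p ^+ L => a1 a2.
have b1 : u - q != 0.
  have -> : u - q = u * (1 - q / u) by field.
  by rewrite mulf_neq0.
have b2 : q - u != 0 by rewrite -opprB oppr_eq0.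
by field; rewrite q0 u0 b1 b2.
Qed.

(** The outermost variable n_m = [s] is peeled off and becomes the [L] of the next level; for a = 0
    no level is shifted. *)
Fixpoint S_fin (a m L : nat) : K :=
  if m is m'.+1 then
    \sum_(0 <= s < (L + (a == m)).+1)
      qbinom p (L + (a == m)) s * q ^+ (s ^ 2) * S_fin a m' s
  else 1.

Lemma geom_coef0 r : geom_coef 0 r = 1.
Proof. by rewrite /geom_coef big_ord1. Qed.

Lemma S_fin_lt a m L : (m < a)%N -> S_fin a m L = S_fin 0 m L.
Proof.
elim: m L => [//|m IHm] L ma /=; rewrite (gtn_eqF ma); apply: eq_bigr => s _.
by rewrite IHm // ltnW.
Qed.

(** The factor q^(r^2) of a Bailey step turns [theta_coef m] into [theta_coef m.+1]; any other
    factor [F] is carried along. *)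
Lemma S_fin_step a m (F : int -> K) L N : (L + (a == m.+1) <= N)%N ->
    (forall s, (s <= N)%N ->
      S_fin a m s = \sum_(r <- zwin N) theta_coef m r * F r * bailey q s r) ->
  S_fin a m.+1 L = \sum_(r <- zwin N)
    theta_coef m.+1 r * F r * bailey q (L + (a == m.+1)) r.
Proof.
move=> LN IH; rewrite [LHS]/=.
rewrite (sum_bailey_step q0 q1 (alpha := fun r => theta_coef m r * F r) LN).
  apply: eq_bigr => r _; rewrite [theta_coef m r * _ * _]mulrAC.
  congr (_ * _ * _).
  by rewrite /theta_coef -mulrA -expfzDr //; congr (_ * _ ^ _); lia.
by move=> s sL; apply: IH; lia.
Qed.

(** Induction on the number of variables. Below level a there is no shift; at level a it replaces L
    by L + 1, which [bailey_shift] converts into [geom_coef a]; the higher levels only multiply by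
    q^(r^2). *)
Lemma S_finE a m L N : (a <= m)%N -> (L <= N)%N ->
  S_fin a m L =
  \sum_(r <- zwin N) theta_coef m r * geom_coef a r * bailey q L r.
Proof.
have windowE b k M s : (s <= M)%N ->
  \sum_(r <- zwin s) theta_coef k r * geom_coef b r * bailey q s r =
  \sum_(r <- zwin M) theta_coef k r * geom_coef b r * bailey q s r.
  by move=> sM; rewrite (sum_bailey_window q _ (leqnn s) sM).
have S0E k M s : (s <= M)%N -> S_fin 0 k s =
    \sum_(r <- zwin M) theta_coef k r * geom_coef 0 r * bailey q s r.
  elim: k M s => [|k IHk] M s sM.
    rewrite [LHS]/= -[LHS](one_bailey q0 q1 sM); apply: eq_bigr => r _.
    by rewrite geom_coef0 mulr1.
  by rewrite (@S_fin_step 0 k (geom_coef 0) s M) ?addn0 // => t tM; apply: IHk.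
elim: m L N => [|m IHm] L N.
  by rewrite leqn0 => /eqP -> LN; rewrite -S0E.
rewrite leq_eqVlt => /orP[/eqP ->|am] LN; last first.
  rewrite (@S_fin_step a m (geom_coef a) L N) ?(ltn_eqF am) ?addn0 //.
  by move=> s sN; apply: IHm.
transitivity (S_fin 0 m.+1 L.+1).
  rewrite /= eqxx addn1 addn0; apply: eq_bigr => s _.
  by rewrite S_fin_lt.
(* The window N + 1 accommodates L + 1 and gives the strict inequality required by [bailey_shift];
   afterwards it shrinks back to N. *)
rewrite (S0E _ N.+1) //; under eq_bigr => r _ do rewrite geom_coef0 mulr1.
by rewrite bailey_shift // -(windowE _ _ _ _ (leqW LN)) (windowE _ _ _ _ LN).
Qed.

End Shift.

(** * Convergence in the complex numbers *)

Local Open Scope classical_set_scope.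
Local Open Scope complex_scope.

Lemma ler_sum_subseq (V : numDomainType) (I : eqType) (s t : seq I)
    (F : I -> V) : uniq s -> uniq t -> {subset s <= t} ->
  (forall i, 0 <= F i) -> \sum_(i <- s) F i <= \sum_(i <- t) F i.
Proof.
move=> us ut st F0; rewrite [leRHS](bigID (mem s)) /=.
rewrite -[X in _ <= X + _]big_filter.
rewrite [X in _ <= X + _](perm_big s) /=; first by rewrite lerDl sumr_ge0.
apply: uniq_perm; rewrite ?filter_uniq // => i; rewrite mem_filter /=.
by case: (boolP (i \in s)) => // /st ->.
Qed.

(** A finite sum within [e] of the supremum leaves less than [e] for any finite set disjoint from
    its support. *)
Lemma small_tails (R : realType) (I : choiceType) (M : I -> R) (b : R) :
    (forall i, 0 <= M i) ->
    (forall s : seq I, uniq s -> \sum_(i <- s) M i <= b) ->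
  forall e, 0 < e -> exists A : {fset I},
    forall s : seq I, uniq s -> {in s, forall i, i \notin A} ->
      \sum_(i <- s) M i < e.
Proof.
move=> M0 Mb e e0.
pose E := [set x | exists2 s : seq I, uniq s & x = \sum_(i <- s) M i].
have supE : has_sup E.
  split; first by exists 0, [::] => //; rewrite big_nil.
  by exists b => _ [s us ->]; exact: Mb.
have [_ [s us ->] es] := sup_adherent e0 supE.
exists [fset i in s]%fset => t ut ts.
have : \sum_(i <- s ++ t) M i <= sup E.
  apply: ub_le_sup; first exact: supE.2.
  exists (s ++ t) => //; rewrite cat_uniq us ut andbT /= -all_predC.
  by apply/allP => i /ts /=; rewrite inE.
by rewrite big_cat /=; lra.
Qed.

(* [R[i]] carries its topology only through its structure of numFieldType. *)
Definition Cnum (R : realType) : numFieldType := R[i].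

Section Complex.
Variable R : realType.
Local Notation C := (Cnum R).

(** In the partial order of R[i] positive elements are real, so limits need only be tested against
    real [e]. *)
Lemma gt0_complex (e : C) : 0 < e -> exists2 e' : R, 0 < e' & e = e'%:C.
Proof. by case: e => a b; rewrite ltcE /= => /andP[/eqP -> a0]; exists a. Qed.

Lemma normc_complex (z : C) : exists2 x : R, 0 <= x & `|z| = x%:C.
Proof. rewrite normc_def.
by exists (Num.sqrt (complex.Re z ^+ 2 + complex.Im z ^+ 2)); rewrite ?sqrtr_ge0.
Qed.

Lemma cvgC_lt (T : Type) (F : set_system T) (FF : Filter F) (f : T -> C)
    (l : C) :
  (forall e : R, 0 < e -> \forall t \near F, `|l - f t| < e%:C) -> f @ F --> l.
Proof.
move=> H; apply/cvgrPdist_lt => _ /gt0_complex[e e0 ->]; exact: H.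
Qed.

Lemma cvgC_ltP (T : Type) (F : set_system T) (FF : Filter F) (f : T -> C)
    (l : C) :
  f @ F --> l -> (forall e : R, 0 < e -> \forall t \near F, `|l - f t| < e%:C).
Proof.
by move=> /cvgrPdist_lt H e e0; apply: H; rewrite ltcR.
Qed.

Lemma cvg_norm_le (u : nat -> C) (l : C) (b : R) :
  u @ \oo --> l -> (forall n, `|u n| <= b%:C) -> `|l| <= b%:C.
Proof.
move=> ul ub; have [x x0 xE] := normc_complex l; rewrite xE lecR.
apply/ler_addgt0Pr => e e0; rewrite -lecR -xE.
have /cvgC_ltP /(_ e e0) [N _ /(_ N (leqnn N)) /= lN] := ul.
rewrite -[l](subrK (u N)) addrC rmorphD /=.
by rewrite (le_trans (ler_normD _ _)) // lerD // ltW.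
Qed.

Lemma cvg_complex (a b : nat -> R) (x y : R) :
  a @ \oo --> x -> b @ \oo --> y ->
  (fun n => Complex (a n) (b n) : C) @ \oo --> (Complex x y : C).
Proof.
move=> ax by_; apply: cvgC_lt => e e0.
have e20 : 0 < e / 2 by rewrite divr_gt0.
have /cvgrPdist_lt /(_ _ e20) ax' := ax.
have /cvgrPdist_lt /(_ _ e20) by_' := by_.
near=> n.
have H1 : `|x - a n| < e / 2 by near: n.
have H2 : `|y - b n| < e / 2 by near: n.
rewrite normc_def ltcR /=.
apply: (@le_lt_trans _ _ (`|x - a n| + `|y - b n|)); last by lra.
rewrite -[leRHS]ger0_norm ?addr_ge0 // -sqrtr_sqr ler_sqrt ?sqr_ge0 //.
rewrite -[X in X + _ <= _]real_normK ?num_real //.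
rewrite -[X in _ + X <= _]real_normK ?num_real //.
by rewrite sqrrD [leRHS]addrAC lerDl mulrn_wge0 // mulr_ge0.
Unshelve. all: by end_near. Qed.

(** The increments form an absolutely convergent series whose partial sums telescope. *)
Lemma cvg_geometric_incr (v : nat -> R) (c x : R) : 0 <= x -> x < 1 ->
  (forall n, `|v n.+1 - v n| <= c * x ^+ n) -> cvg (v @ \oo).
Proof.
move=> x0 x1 vx.
have /normed_cvg : cvgn [normed series (telescope v)].
  apply: (@series_le_cvg _ _ (geometric c x)).
  - by move=> n; exact: normr_ge0.
  - by move=> n; exact: le_trans (normr_ge0 _) (vx n).
  - exact: vx.
  - by apply: is_cvg_geometric_series; rewrite ger0_norm.
move=> /cvg_ex[l vl]; apply/cvg_ex; exists (v 0%N + l).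
have : (fun n => v 0%N + series (telescope v) n) @ \oo --> v 0%N + l.
  by apply: cvgD => //; exact: cvg_cst.
rewrite (_ : (fun n => _) = v) //; apply/funext => n.
by rewrite seriesEnat /= telescope_sumr // addrC subrK.
Qed.

Lemma normc_ge_Im (z : C) : `|complex.Im z|%:C <= `|z|.
Proof.
case: z => a b; rewrite normc_def lecR /= -sqrtr_sqr.
by rewrite ler_wsqrtr // lerDr sqr_ge0.
Qed.

(** Completeness enters only through the reals: real and imaginary parts are treated separately. *)
Lemma cvgC_geometric_incr (u : nat -> C) (c x : R) : 0 <= x -> x < 1 ->
  (forall n, `|u n.+1 - u n| <= (c * x ^+ n)%:C) -> cvg (u @ \oo).
Proof.
move=> x0 x1 ux.
have /cvg_ex[a ua] : cvg ((fun n => complex.Re (u n)) @ \oo).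
  apply: (@cvg_geometric_incr _ c x) => // n; rewrite -lecR.
  apply: le_trans (ux n); rewrite -(raddfB (@complex.Re R)).
  exact: normc_ge_Re.
have /cvg_ex[b ub] : cvg ((fun n => complex.Im (u n)) @ \oo).
  apply: (@cvg_geometric_incr _ c x) => // n; rewrite -lecR.
  apply: le_trans (ux n); rewrite -(raddfB (@complex.Im R)).
  exact: normc_ge_Im.
apply/cvg_ex; exists (Complex a b : C).
have -> : u = (fun n => Complex (complex.Re (u n)) (complex.Im (u n)) : C).
  by apply/funext => n; case: (u n).
exact: cvg_complex.
Qed.

End Complex.

Lemma cvg_sum_seq (K : numFieldType) (I : eqType) (s : seq I)
    (F : nat -> I -> K) (f : I -> K) :
    (forall i, i \in s -> F^~ i @ \oo --> f i) ->
  (fun n => \sum_(i <- s) F n i) @ \oo --> \sum_(i <- s) f i.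
Proof.
elim: s => [|i s IHs] Ff.
  rewrite big_nil; under eq_fun do rewrite big_nil; exact: cvg_cst.
rewrite big_cons; under eq_fun do rewrite big_cons; apply: cvgD.
  by apply: Ff; rewrite mem_head.
by apply: IHs => j js; apply: Ff; rewrite inE js orbT.
Qed.

Lemma partial_sumE (I : choiceType) (V : zmodType) (f : I -> V) (A : {fset I}) :
  partial_sum f A = \sum_(i <- A) f i.
Proof. by rewrite /partial_sum (big_seq_fsetE _ _ xpredT). Qed.

Lemma big_fset_split (V : nmodType) (I : choiceType) (A : {fset I}) (s : seq I)
    (F : I -> V) : uniq s -> {in A, forall i, i \in s} ->
  \sum_(i <- s) F i =
  \sum_(i <- A) F i + \sum_(i <- [seq i <- s | i \notin A]) F i.
Proof.
move=> us As; rewrite [LHS](bigID (mem A)) /= big_filter; congr (_ + _).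
rewrite -big_filter; apply: perm_big; apply: uniq_perm.
- by rewrite filter_uniq.
- exact: fset_uniq.
- move=> i; rewrite mem_filter /=.
  by case: (boolP (i \in A)) => // /As ->.
Qed.

#[local] Existing Instance totally_filter.

(** * Dominated convergence for sums (Tannery's theorem) *)

Section Tannery.
Variables (R : realType) (I : choiceType).
Local Notation C := (Cnum R).
Variables (f : I -> C) (F : nat -> I -> C) (M : I -> R) (b : R).
(** Arbitrary exhausting lists are allowed, since both windows of integers and boxes of tuples
    occur. *)
Variable s : nat -> seq I.
Hypotheses (M0 : forall i, 0 <= M i)
  (Mb : forall t : seq I, uniq t -> \sum_(i <- t) M i <= b)
  (FM : forall n i, `|F n i| <= (M i)%:C)
  (Ff : forall i, F^~ i @ \oo --> f i)
  (us : forall n, uniq (s n))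
  (si : forall i, \forall n \near \oo, i \in s n).

Let norm_sum_le (G : I -> C) (t : seq I) :
  (forall i, `|G i| <= (M i)%:C) ->
  `|\sum_(i <- t) G i| <= (\sum_(i <- t) M i)%:C.
Proof.
move=> GM; rewrite rmorph_sum /=.
by rewrite (le_trans (ler_norm_sum _ _ _)) // ler_sum.
Qed.

(** Off a suitable A the dominating [M] sums to less than e/3, which controls the tails of [f] and
    of [F n]; on A there are finitely many convergent terms. As B comes after n, the estimate
    transfers limits in both directions. *)
Lemma tannery_close (e : R) : 0 < e -> exists A : {fset I},
  \forall n \near \oo, forall B : {fset I}, (A `<=` B)%fset ->
    `|partial_sum f B - \sum_(i <- s n) F n i| < e%:C.
Proof.
move=> e0; have e30 : 0 < e / 3 by rewrite divr_gt0.
have [A tailA] := small_tails M0 Mb e30.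
have fM i : `|f i| <= (M i)%:C.
  by apply: (cvg_norm_le (@Ff i)) => n; exact: FM.
exists A.
have As : \forall n \near \oo, {in A, forall i, i \in s n}.
  suff : \forall n \near \oo, all (fun i => i \in s n) A.
    by apply: filterS => n /allP.
  elim: (enum_fset A) => [|i t IHt] /=; first by near=> n.
  near=> n; apply/andP; split; near: n => //; exact: si.
have /cvgC_ltP /(_ _ e30) fA :=
  @cvg_sum_seq _ _ (enum_fset A) _ _ (fun i _ => @Ff i).
near=> n => B AB; rewrite partial_sumE.
have An : {in A, forall i, i \in s n} by near: n.
have fFn : `|\sum_(i <- A) f i - \sum_(i <- A) F n i| < (e / 3)%:C by near: n.
rewrite (big_fset_split f (fset_uniq B) (fsubsetP AB)).
rewrite (big_fset_split (F n) (us n) An).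
set f1 := \sum_(i <- A) f i; set f2 := \sum_(i <- _) f i.
set F1 := \sum_(i <- A) F n i; set F2 := \sum_(i <- _) F n i.
have -> : f1 + f2 - (F1 + F2) = (f1 - F1) + (f2 - F2) by ring.
have -> : e%:C = (e / 3)%:C + ((e / 3)%:C + (e / 3)%:C).
  by rewrite -!rmorphD /=; congr (_%:C); field.
rewrite (le_lt_trans (ler_normD _ _)) // ltrD //.
rewrite (le_lt_trans (ler_normB _ _)) // ltrD //.
- rewrite (le_lt_trans (norm_sum_le _ fM)) // ltcR tailA ?filter_uniq //.
  by move=> i; rewrite mem_filter => /andP[].
- rewrite (le_lt_trans (norm_sum_le _ (FM n))) // ltcR tailA ?filter_uniq //.
  by move=> i; rewrite mem_filter => /andP[].
Unshelve. all: by end_near. Qed.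

(** For the triple product and the multiple sum, where the limit of the finite sums is known
    first. *)
Lemma tannery_totally (l : C) : (fun n => \sum_(i <- s n) F n i) @ \oo --> l ->
  partial_sum f @ totally --> l.
Proof.
move=> sl; apply: cvgC_lt => e e0.
have e20 : 0 < e / 2 by rewrite divr_gt0.
have [A closeA] := tannery_close e20.
have /cvgC_ltP /(_ _ e20) sl' := sl.
exists A => // B AB /=.
near \oo => n.
have H1 : `|l - \sum_(i <- s n) F n i| < (e / 2)%:C by near: n.
have H2 : `|partial_sum f B - \sum_(i <- s n) F n i| < (e / 2)%:C.
  have : forall B : {fset I}, (A `<=` B)%fset ->
    `|partial_sum f B - \sum_(i <- s n) F n i| < (e / 2)%:C by near: n.
  exact.
have -> : e%:C = (e / 2)%:C + (e / 2)%:C.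
  by rewrite -!rmorphD /=; congr (_%:C); field.
rewrite (le_lt_trans (ler_distD (\sum_(i <- s n) F n i) _ _)) //.
by rewrite ltrD // distrC.
Unshelve. all: by end_near. Qed.

(** For the theta series weighted by [bailey], where the sum of the limit series is known first,
    from the triple product. *)
Lemma tannery_seq (l : C) : partial_sum f @ totally --> l ->
  (fun n => \sum_(i <- s n) F n i) @ \oo --> l.
Proof.
move=> fl; apply: cvgC_lt => e e0.
have e20 : 0 < e / 2 by rewrite divr_gt0.
have [A closeA] := tannery_close e20.
have /cvgC_ltP /(_ _ e20) [A' _ fl'] := fl.
near=> n.
have H1 := fl' (A `|` A')%fset (fsubsetUr _ _).
have H2 : `|partial_sum f (A `|` A')%fset - \sum_(i <- s n) F n i| < (e / 2)%:C.
  have : forall B : {fset I}, (A `<=` B)%fset ->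
    `|partial_sum f B - \sum_(i <- s n) F n i| < (e / 2)%:C by near: n.
  by apply; exact: fsubsetUl.
have -> : e%:C = (e / 2)%:C + (e / 2)%:C.
  by rewrite -!rmorphD /=; congr (_%:C); field.
rewrite (le_lt_trans (ler_distD (partial_sum f (A `|` A')%fset) _ _)) //.
by rewrite ltrD.
Unshelve. all: by end_near. Qed.

End Tannery.

(** * Limits of q-products and the theta series *)

Section ProductLimits.
Variable R : realType.
Local Notation C := (Cnum R).
Implicit Types x p : C.

Lemma sum_geometric_le (b : R) n : 0 < b < 1 ->
  \sum_(0 <= j < n) b ^+ j <= (1 - b)^-1.
Proof.
move=> /andP[b0 b1]; have := @geometric_le_lim R n 1 b ler01 b0.
rewrite (ger0_norm (ltW b0)) => /(_ b1); rewrite mul1r seriesEnat /=.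
by under eq_bigr do rewrite mul1r.
Qed.

(** By 1 + x <= exp x the product is at most the exponential of a geometric sum. *)
Lemma norm_prod_le (F : nat -> C) (c b : R) n : 0 <= c -> 0 < b < 1 ->
    (forall j, `|F j| <= (1 + c * b ^+ j)%:C) ->
  `|\prod_(0 <= j < n) F j| <= (expR (c / (1 - b)))%:C.
Proof.
move=> c0 b01 FE; rewrite normr_prod.
apply: (@le_trans _ _ (\prod_(0 <= j < n) (expR (c * b ^+ j))%:C)).
  apply: ler_prod => j _; rewrite normr_ge0 /=.
  by rewrite (le_trans (FE j)) // lecR expR_ge1Dx.
rewrite -rmorph_prod /= lecR -expR_sum ler_expR -big_distrr /=.
by rewrite ler_wpM2l // sum_geometric_le.
Qed.

Lemma norm_lt1_complex p : p != 0 -> `|p| < 1 ->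
  exists2 b : R, 0 < b < 1 & `|p| = b%:C.
Proof.
move=> p0 p1; have [b _ bE] := normc_complex p; exists b => //.
by rewrite -!ltcR -bE p1 normr_gt0 p0.
Qed.

Lemma expr_norm_lt1 p n : `|p| < 1 -> p ^+ n.+1 != 1.
Proof.
move=> p1; apply: contraTneq p1 => pn1.
have : `|p| ^+ n.+1 = 1 by rewrite -normrX pn1 normr1.
by move=> /eqP; rewrite pexprn_eq1 //= => /eqP ->; rewrite ltxx.
Qed.

Lemma qpoch_bounded x p : p != 0 -> `|p| < 1 ->
  exists2 k : R, 0 < k & forall n, `|qpoch x p n| <= k%:C.
Proof.
move=> p0 p1; have [b b01 bE] := norm_lt1_complex p0 p1.
have [a a0 aE] := normc_complex x.
exists (expR (a / (1 - b))); first exact: expR_gt0.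
move=> n; apply: norm_prod_le => // j.
rewrite (le_trans (ler_normB _ _)) // normr1 normrM normrX aE bE.
by rewrite rmorphD rmorph1 rmorphM rmorphXn.
Qed.

Lemma qpochV_bounded p : p != 0 -> `|p| < 1 ->
  exists2 k : R, 0 < k & forall n, `|(qpoch p p n)^-1| <= k%:C.
Proof.
move=> p0 p1; have [b b01 bE] := norm_lt1_complex p0 p1.
(* The constant comes from 1/(1-y) <= 1 + y/(1-b) for 0 < y <= b, with y = b^(j+1). *)
exists (expR (b / (1 - b) / (1 - b))); first exact: expR_gt0.
move=> n; rewrite /qpoch -prodfV; apply: norm_prod_le => //.
  by case/andP: b01 => b0 b1; rewrite divr_ge0 ?subr_ge0 // ltW.
move=> j; have /andP[b0 b1] := b01.
have [w w0 wE] := normc_complex (1 - p * p ^+ j).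
set y := b * b ^+ j.
have yb : y <= b by rewrite /y ler_piMr ?exprn_ile1 ?ltW.
have y0 : 0 < y by rewrite mulr_gt0 ?exprn_gt0.
have wy : 1 - y <= w.
  rewrite -lecR -wE rmorphB rmorph1 /y rmorphM rmorphXn /= -bE -normrX -normrM.
  by rewrite -[X in X - _]normr1 lerB_dist.
have wgt0 : 0 < w by lra.
rewrite normfV wE -fmorphV lecR -[leLHS]mul1r ler_pdivrMr //.
have b10 : 0 < 1 - b by lra.
have b1n : 1 - b != 0 by rewrite gt_eqF.
have -> : b / (1 - b) * b ^+ j = y / (1 - b) by rewrite /y; field.
apply: (@le_trans _ _ ((1 + y / (1 - b)) * (1 - y))); last first.
  by rewrite ler_wpM2l // addr_ge0 // divr_ge0 // ltW.
rewrite -subr_ge0.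
have -> : (1 + y / (1 - b)) * (1 - y) - 1 = y * (b - y) / (1 - b).
  by field.
by rewrite divr_ge0 ?(ltW b10) // mulr_ge0 ?subr_ge0 ?(ltW y0).
Qed.

(** Consecutive values differ by (x; p)_n x p^n, geometrically small since (x; p)_n is bounded. *)
Lemma cvg_qpoch x p : p != 0 -> `|p| < 1 ->
  qpoch x p @ \oo --> qpoch_inf x p.
Proof.
move=> p0 p1; have [b /andP[b0 b1] bE] := norm_lt1_complex p0 p1.
have [a a0 aE] := normc_complex x.
have [k k0 kE] := qpoch_bounded x p0 p1.
apply: (@cvgC_geometric_incr _ _ (k * a) b) => //; first exact: ltW.
move=> n; rewrite qpochS.
have -> : qpoch x p n * (1 - x * p ^+ n) - qpoch x p n =
    - (qpoch x p n * x * p ^+ n) by ring.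
rewrite normrN !normrM normrX aE bE !rmorphM rmorphXn /=.
apply: ler_wpM2r; first by rewrite exprn_ge0 // ler0c ltW.
by apply: ler_wpM2r; [rewrite ler0c|exact: kE].
Qed.

(** The inverses of (p; p)_n are bounded, so (p; p)_n stays away from 0. *)
Lemma qpoch_inf_neq0 p : p != 0 -> `|p| < 1 -> qpoch_inf p p != 0.
Proof.
move=> p0 p1; have [k k0 kE] := qpochV_bounded p0 p1.
apply/eqP => l0; have := @cvg_qpoch p p p0 p1; rewrite l0.
have kV0 : 0 < k^-1 by rewrite invr_gt0.
move=> /cvgC_ltP /(_ _ kV0) [N _ /(_ N (leqnn N)) /=].
rewrite sub0r normrN; apply/negP; rewrite -real_leNgt ?num_real //.
  rewrite fmorphV -[leRHS]invrK -normfV lef_pV2 ?kE //.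
  - by rewrite posrE lt_def ler0c (ltW k0) fmorph_eq0 gt_eqF.
  - rewrite posrE normr_gt0 invr_eq0 qpoch_neq0 // => j; exact: expr_norm_lt1.
- by rewrite realE ler0c invr_ge0 ltW.
Qed.

Lemma cvg_qpochV p : p != 0 -> `|p| < 1 ->
  (fun n => (qpoch p p n)^-1) @ \oo --> (qpoch_inf p p)^-1.
Proof.
by move=> p0 p1; apply: cvgV; [exact: qpoch_inf_neq0|exact: cvg_qpoch].
Qed.

End ProductLimits.

Lemma sum_geometric_int_le (R : realType) (b : R) (t : seq int) :
    0 < b < 1 -> uniq t ->
  \sum_(r <- t) b ^+ absz r <= 2 / (1 - b).
Proof.
move=> b01 ut; have /andP[b0 b1] := b01.
have b0n n : 0 <= b ^+ n by rewrite exprn_ge0 // ltW.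
pose N := (\max_(r <- t) absz r)%N.
have tN : {subset t <= zwin N}.
  by move=> r rt; rewrite mem_zwin; exact: leq_bigmax_seq.
apply: (@le_trans _ _ (\sum_(r <- zwin N) b ^+ absz r)).
  by apply: ler_sum_subseq => //; exact: zwin_uniq.
rewrite big_zwin (big_cat_nat (n := N)) //=; last by lia.
have -> : 2 / (1 - b) = (1 - b)^-1 + (1 - b)^-1 by rewrite -mulr2n mulr_natl.
apply: lerD.
  rewrite big_nat_rev /= add0n.
  apply: le_trans (sum_geometric_le N b01).
  rewrite !big_nat; apply: ler_sum => j /andP[_ jN].
  apply: ler_wiXn2l; rewrite ?ltW //; lia.
rewrite -{1}[N]add0n big_addn.
apply: le_trans (sum_geometric_le ((2 * N).+1 - N) b01).
by apply: ler_sum => j _; rewrite PoszD addrK.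
Qed.

Lemma cvg_nat_le (h : nat -> nat) c : (forall n, (n <= h n + c)%N) ->
  h @ \oo --> \oo.
Proof.
move=> hc S [N _ NS]; exists (N + c)%N => // n /= Nn; apply: NS => /=.
by rewrite -(leq_add2r c) (leq_trans Nn).
Qed.

Lemma cvg_eventually (K : numFieldType) (u v : nat -> K) (l : K) N :
  (forall n, (N <= n)%N -> u n = v n) -> u @ \oo --> l -> v @ \oo --> l.
Proof.
move=> uv; apply: cvg_trans; apply: near_eq_cvg.
by exists N => // n /= Nn; rewrite uv.
Qed.

(** * Limits and uniform bounds of q-binomials *)

Section BinomialLimits.
Variable R : realType.
Local Notation C := (Cnum R).
Variable p : C.
Hypotheses (p0 : p != 0) (p1 : `|p| < 1).

Let P0 n : qpoch p p n != 0.
Proof. by apply: qpoch_neq0 => j; exact: expr_norm_lt1. Qed.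

Lemma cvg_subseq_qpoch x (h : nat -> nat) : h @ \oo --> \oo ->
  (fun n => qpoch x p (h n)) @ \oo --> qpoch_inf x p.
Proof.
move=> hoo.
exact: (@cvg_comp _ _ _ h (qpoch x p) _ _ _ hoo (@cvg_qpoch _ x p p0 p1)).
Qed.

Lemma cvg_subseq_qpochV (h : nat -> nat) : h @ \oo --> \oo ->
  (fun n => (qpoch p p (h n))^-1) @ \oo --> (qpoch_inf p p)^-1.
Proof. by move=> hoo; 
exact: (@cvg_comp _ _ _ h (fun n => (qpoch p p n)^-1) _ _ _ hoo
  (@cvg_qpochV _ p p0 p1)). Qed.

Lemma cvg_qbinom k c :
  (fun n => qbinom p (n + c) k) @ \oo --> (qpoch p p k)^-1.
Proof.
have L0 := qpoch_inf_neq0 p0 p1.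
apply: (@cvg_eventually _ (fun n => qpoch p p (n + c) *
    ((qpoch p p (n + c - k))^-1 * (qpoch p p k)^-1)) _ _ k).
  by move=> n kn; rewrite /qbinom (leq_trans kn) ?leq_addr // invfM.
rewrite -[X in _ --> X](mulVKf L0).
apply: cvgM.
  by apply: cvg_subseq_qpoch; apply: (@cvg_nat_le _ 0) => n; lia.
apply: cvgM; last exact: cvg_cst.
by apply: cvg_subseq_qpochV; apply: (@cvg_nat_le _ k) => n; lia.
Qed.

Lemma cvg_cbin r : (fun n => cbin p n r) @ \oo --> (qpoch_inf p p)^-1.
Proof.
have L0 := qpoch_inf_neq0 p0 p1.
apply: (@cvg_eventually _ (fun n => qpoch p p (2 * n) *
    ((qpoch p p (n - absz r))^-1 * (qpoch p p (n + absz r))^-1)) _ _ (absz r)).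
  by move=> n kn; rewrite /cbin kn invfM.
rewrite -[X in _ --> X](mulVKf L0).
apply: cvgM.
  by apply: cvg_subseq_qpoch; apply: (@cvg_nat_le _ 0) => n; lia.
apply: cvgM.
  by apply: cvg_subseq_qpochV; apply: (@cvg_nat_le _ (absz r)) => n; lia.
by apply: cvg_subseq_qpochV; apply: (@cvg_nat_le _ 0) => n; lia.
Qed.

Lemma qbinom_bounded : exists2 k : R, 0 < k &
  forall n j, `|qbinom p n j| <= k%:C.
Proof.
have [k1 k10 k1E] := qpoch_bounded p p0 p1.
have [k2 k20 k2E] := qpochV_bounded p0 p1.
exists (k1 * (k2 * k2)); first by rewrite !mulr_gt0.
move=> n j; rewrite /qbinom; case: ifP => _; last first.
  by rewrite normr0 ler0c ltW // !mulr_gt0.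
by rewrite invfM !normrM !rmorphM /= !ler_pM ?mulr_ge0 ?normr_ge0.
Qed.

Lemma cbin_bounded : exists2 k : R, 0 < k &
  forall n r, `|cbin p n r| <= k%:C.
Proof.
have [k1 k10 k1E] := qpoch_bounded p p0 p1.
have [k2 k20 k2E] := qpochV_bounded p0 p1.
exists (k1 * (k2 * k2)); first by rewrite !mulr_gt0.
move=> n j; rewrite /cbin; case: ifP => _; last first.
  by rewrite normr0 ler0c ltW // !mulr_gt0.
by rewrite invfM !normrM !rmorphM /= !ler_pM ?mulr_ge0 ?normr_ge0.
Qed.

End BinomialLimits.

(** The general term of the triple product series with Q = q^(m+2) and z = q^(-(1+2a)). *)
Definition theta_term (K : fieldType) (q : K) (m a : nat) (r : int) : K :=
  (-1) ^ r * (q ^+ m.+2) ^ (r * r) * (q ^ (- (1 + 2 * a)%:Z)) ^ r.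

Lemma theta_coef_geom (K : numFieldType) (q : K) m a r : q != 0 ->
  theta_coef q m r * geom_coef q a r =
  \sum_(0 <= i < a.+1) q ^+ i * theta_term q m i r.
Proof.
move=> q0; rewrite /geom_coef.
rewrite -(big_mkord xpredT (fun i => (q ^ (1 - 2 * r)) ^+ i)).
rewrite big_distrr /=; apply: eq_bigr => i _.
rewrite /theta_coef /theta_term !exprnP !exprz_exp -!mulrA -!expfzDr //.
by rewrite [RHS]mulrCA -!expfzDr //; congr (_ * _ ^ _); lia.
Qed.

Lemma triple_product_args (K : fieldType) (q : K) m a : q != 0 ->
  [:: q ^ (m%:Z + 1 - 2 * a%:Z); q ^+ (m + 3 + 2 * a); q ^+ (2 * m + 4)] =
  [:: q ^ (- (1 + 2 * a)%:Z) * q ^+ m.+2; q ^+ m.+2 / q ^ (- (1 + 2 * a)%:Z);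
      (q ^+ m.+2) ^+ 2].
Proof.
move=> q0.
have -> : q ^+ (2 * m + 4) = (q ^+ m.+2) ^+ 2.
  by rewrite -exprM; congr (_ ^+ _); lia.
have -> : q ^ (m%:Z + 1 - 2 * a%:Z) = q ^ (- (1 + 2 * a)%:Z) * q ^+ m.+2.
  by rewrite exprnP -expfzDr //; congr (_ ^ _); lia.
have -> : q ^+ (m + 3 + 2 * a) = q ^+ m.+2 / q ^ (- (1 + 2 * a)%:Z).
  by rewrite invr_expz !exprnP -expfzDr //; congr (_ ^ _); lia.
by [].
Qed.

Lemma qpoch_infs3 (K : numFieldType) (x y z p : K) :
  qpoch_infs [:: x; y; z] p = qpoch_inf x p * qpoch_inf y p * qpoch_inf z p.
Proof. by rewrite /qpoch_infs !big_cons big_nil mulr1 mulrA. Qed.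

Section Theta.
Variable R : realType.
Local Notation C := (Cnum R).
Variable q : C.
Hypotheses (q0 : q != 0) (q1 : `|q| < 1).
Local Notation p := (q ^+ 2).

Let p0 : p != 0. Proof. exact: expf_neq0. Qed.
Let p1 : `|p| < 1. Proof. by rewrite normrX expr_lt1. Qed.
Let q_neq1 n : q ^+ n.+1 != 1. Proof. exact: expr_norm_lt1. Qed.

Lemma cvg_bailey r :
  (fun L => bailey q L r) @ \oo --> qpoch_inf (- q) p / qpoch_inf p p.
Proof.
have L0 := qpoch_inf_neq0 p0 p1.
rewrite -[qpoch_inf (- q) p](mulfK L0).
apply: cvgM; last exact: cvg_cbin.
apply: cvgM; last first.
  by apply: cvg_subseq_qpochV => //; apply: (@cvg_nat_le _ 0) => n; lia.
by apply: cvgM; exact: cvg_qpoch.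
Qed.

Lemma bailey_bounded : exists2 k : R, 0 < k &
  forall L r, `|bailey q L r| <= k%:C.
Proof.
have [k1 k10 k1E] := qpoch_bounded (- q) p0 p1.
have [k2 k20 k2E] := qpoch_bounded p p0 p1.
have [k3 k30 k3E] := qpochV_bounded p0 p1.
have [k4 k40 k4E] := cbin_bounded p0 p1.
exists (k1 * k2 * k3 * k4); first by rewrite !mulr_gt0.
move=> L r; rewrite /bailey.
by rewrite !normrM !rmorphM /= !ler_pM ?mulr_ge0 ?normr_ge0.
Qed.

(** The exponent e of [q] may be negative, whence the constant b^(-(m+2)). One has |r| <= e + m + 2
    because (m+2)(r^2+1) - (1+2a)|r| = (m+2)(|r|-1)^2 + (2(m-a)+3)|r|. *)
Lemma theta_term_bounded m a : (a <= m)%N -> exists2 k : R, 0 < k &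
  exists2 b : R, 0 < b < 1 &
    forall r, `|theta_term q m a r| <= (k * b ^+ absz r)%:C.
Proof.
move=> am; have [b b01 bE] := norm_lt1_complex q0 q1.
have /andP[b0 b1] := b01.
exists (b ^- m.+2); first by rewrite invr_gt0 exprn_gt0.
exists b => // r; rewrite /theta_term !normrM sign_absz normrX normrN1 expr1n.
rewrite mul1r exprnP !exprz_exp -normrM -expfzDr //.
set e := m.+2%:Z * (r * r) + _.
have [n nE] : exists n : nat, e + m.+2%:Z = n%:Z /\ (absz r <= n)%N.
  have : e + m.+2%:Z >= (absz r)%:Z.
    have H1 : 0 <= (m%:Z - a%:Z) * (absz r)%:Z by rewrite mulr_ge0 //; lia.
    have H2 : 0 <= m.+2%:Z * ((absz r)%:Z - 1) ^+ 2.
      by rewrite mulr_ge0 ?sqr_ge0.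
    have [rE|rE] : r = (absz r)%:Z \/ r = - (absz r)%:Z by lia.
      by rewrite /e rE; nia.
    by rewrite /e rE; nia.
  move=> H; exists (absz (e + m.+2%:Z)); split; lia.
have -> : e = n%:Z - m.+2%:Z by lia.
rewrite expfzDr // -exprnN normrM normfV !normrX bE.
rewrite rmorphM fmorphV !rmorphXn /= mulrC ler_wpM2l //.
  by rewrite invr_ge0 exprn_ge0 // ler0c ltW.
rewrite -!rmorphXn lecR; apply: ler_wiXn2l; rewrite ?ltW //; lia.
Qed.

End Theta.

(** The limit of [finite_triple_product], dominated by the geometric bound. As [cbin] tends to
    1/(Q^2; Q^2)_oo, the series is first obtained divided by that product, which is multiplied back
    at the end. *)
Lemma jacobi_triple_product (R : realType) (Q z : Cnum R) (k b : R) :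
    Q != 0 -> z != 0 -> `|Q| < 1 -> 0 < k -> 0 < b < 1 ->
    (forall r, `|(-1) ^ r * Q ^ (r * r) * z ^ r| <= (k * b ^+ absz r)%:C) ->
  partial_sum (fun r : int => (-1) ^ r * Q ^ (r * r) * z ^ r) @ totally -->
    qpoch_infs [:: z * Q; Q / z; Q ^+ 2] (Q ^+ 2).
Proof.
move=> Q0 z0 Q1 k0 b01 kb.
have Qn n : Q ^+ n.+1 != 1 by exact: expr_norm_lt1.
have P0 : Q ^+ 2 != 0 by exact: expf_neq0.
have P1 : `|Q ^+ 2| < 1 by rewrite normrX expr_lt1.
have L0 := qpoch_inf_neq0 P0 P1.
have [k' k'0 k'E] := cbin_bounded P0 P1.
have PE n := @finite_triple_product _ Q z n Q0 z0 Qn.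
have bino r : (fun n => cbin (Q ^+ 2) n r) @ \oo -->
    (qpoch_inf (Q ^+ 2) (Q ^+ 2))^-1.
  exact: cvg_cbin.
have lims : (fun n => qpoch (z * Q) (Q ^+ 2) n * qpoch (Q / z) (Q ^+ 2) n)
    @ \oo --> qpoch_inf (z * Q) (Q ^+ 2) * qpoch_inf (Q / z) (Q ^+ 2).
  by apply: cvgM; exact: cvg_qpoch.
rewrite qpoch_infs3.
move: (qpoch_inf (Q ^+ 2) (Q ^+ 2)) L0 bino => L L0 bino.
move: (qpoch_inf (z * Q) _ * qpoch_inf _ _) lims => l lims.
set c := fun r : int => _; rewrite -/c in kb.
have /andP[b0 b1] := b01.
have M0 r : 0 <= k * k' * b ^+ absz r.
  by rewrite !mulr_ge0 ?exprn_ge0 ?ltW.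
have Mb (t : seq int) : uniq t ->
    \sum_(r <- t) k * k' * b ^+ absz r <= k * k' * (2 / (1 - b)).
  move=> ut; rewrite -big_distrr /=; apply: ler_wpM2l.
    by rewrite mulr_ge0 ?ltW.
  exact: sum_geometric_int_le.
have lim : partial_sum (fun r => c r * L^-1) @ totally --> l.
  apply: (@tannery_totally R _ _ (fun n r => c r * cbin (Q ^+ 2) n r)
    _ _ zwin M0 Mb).
  - by move=> n r; rewrite normrM mulrAC rmorphM /= ler_pM ?kb ?k'E.
  - by move=> r; apply: cvgM; [exact: cvg_cst|exact: bino].
  - exact: zwin_uniq.
  - by move=> r; exists (absz r) => // n /= rn; rewrite mem_zwin.
  - by under eq_fun do rewrite PE.
have -> : partial_sum c = fun A => partial_sum (fun r => c r * L^-1) A * L.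
  apply/funext => A; rewrite !partial_sumE big_distrl /=.
  by apply: eq_bigr => r _; rewrite mulfVK.
exact: cvgMr_tmp.
Qed.

Section ThetaLimit.
Variable R : realType.
Local Notation C := (Cnum R).
Variable q : C.
Hypotheses (q0 : q != 0) (q1 : `|q| < 1).
Local Notation p := (q ^+ 2).

Let p0 : p != 0. Proof. exact: expf_neq0. Qed.
Let p1 : `|p| < 1. Proof. by rewrite normrX expr_lt1. Qed.
Let q_neq1 n : q ^+ n.+1 != 1. Proof. exact: expr_norm_lt1. Qed.

Definition theta_prod (m a : nat) : C :=
  qpoch_infs [:: q ^ (m%:Z + 1 - 2 * a%:Z); q ^+ (m + 3 + 2 * a);
                 q ^+ (2 * m + 4)] (q ^+ (2 * m + 4)).

Lemma theta_sum m a : (a <= m)%N ->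
  partial_sum (theta_term q m a) @ totally --> theta_prod m a.
Proof.
move=> am.
have [k k0 [b b01 kb]] := theta_term_bounded q0 q1 am.
have Q0 : q ^+ m.+2 != 0 by exact: expf_neq0.
have z0 : q ^ (- (1 + 2 * a)%:Z) != 0 by exact: expfz_neq0.
have Q1 : `|q ^+ m.+2| < 1 by rewrite normrX expr_lt1.
have PE : q ^+ (2 * m + 4) = (q ^+ m.+2) ^+ 2.
  by case: (triple_product_args m 0 q0).
rewrite /theta_prod (triple_product_args m a q0) PE.
exact: (jacobi_triple_product Q0 z0 Q1 k0 b01 kb).
Qed.

Let const : C := qpoch_inf (- q) p / qpoch_inf p p.

Lemma theta_bailey_cvg m a : (a <= m)%N ->
  (fun L => \sum_(r <- zwin L) theta_term q m a r * bailey q L r) @ \oo -->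
  theta_prod m a * const.
Proof.
move=> am; have [k k0 [b b01 kb]] := theta_term_bounded q0 q1 am.
have [k' k'0 k'E] := bailey_bounded q0 q1.
have /andP[b0 b1] := b01.
have M0 r : 0 <= k * k' * b ^+ absz r.
  by rewrite !mulr_ge0 ?exprn_ge0 ?ltW.
have Mb (t : seq int) : uniq t ->
    \sum_(r <- t) k * k' * b ^+ absz r <= k * k' * (2 / (1 - b)).
  move=> ut; rewrite -big_distrr /=; apply: ler_wpM2l.
    by rewrite mulr_ge0 ?ltW.
  exact: sum_geometric_int_le.
apply: (@tannery_seq R _ (fun r => theta_term q m a r * const)
    (fun n r => theta_term q m a r * bailey q n r) _ _ zwin M0 Mb).
- move=> n r; rewrite normrM mulrAC rmorphM /= ler_pM ?kb ?k'E //.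
- by move=> r; apply: cvgM; [exact: cvg_cst|exact: cvg_bailey].
- exact: zwin_uniq.
- by move=> r; exists (absz r) => // n /= rn; rewrite mem_zwin.
- have -> : partial_sum (fun r => theta_term q m a r * const) =
      fun A => partial_sum (theta_term q m a) A * const.
    by apply/funext => A; rewrite !partial_sumE big_distrl.
  by apply: cvgMr_tmp; exact: theta_sum.
Qed.

(** Expanding [geom_coef] splits the sum into a + 1 theta series, each with its own triple
    product. *)
Lemma S_fin_cvg m a : (a <= m)%N ->
  S_fin q a m @ \oo -->
  \sum_(0 <= i < a.+1) q ^+ i * (theta_prod m i * const).
Proof.
move=> am.
have -> : S_fin q a m = (fun L => \sum_(0 <= i < a.+1)
    q ^+ i * \sum_(r <- zwin L) theta_term q m i r * bailey q L r).
  apply/funext => L; rewrite (@S_finE _ q q0 q_neq1 a m L L am (leqnn L)).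
  under [RHS]eq_bigr do rewrite big_distrr /=.
  rewrite exchange_big; apply: eq_bigr => r _ /=.
  rewrite theta_coef_geom // big_distrl; apply: eq_bigr => i _.
  exact: (esym (mulrA _ _ _)).
apply: cvg_sum_seq => i; rewrite mem_index_iota ltnS => /andP[_ ia].
apply: cvgM; first exact: cvg_cst.
by apply: theta_bailey_cvg; exact: leq_trans am.
Qed.

End ThetaLimit.

(** * The multiple sum *)

Lemma tuple_rconsP (T : Type) m (t : m.+1.-tuple T) :
  exists (t' : m.-tuple T) x, t = rcons_tuple t' x.
Proof.
case: t => s; case/lastP: s => [//|s x] sm.
have sz : size s == m by move: sm; rewrite size_rcons.
by exists (Tuple sz), x; apply: val_inj.
Qed.

(** Built by appending the last entry, the outermost variable n_m, to match the recursion of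
    [S_fin]. *)
Fixpoint box (k m : nat) : seq (m.-tuple nat) :=
  if m is m'.+1 then
    [seq rcons_tuple t x | x <- iota 0 k, t <- box k m']
  else [:: [tuple]].

Lemma big_boxS (V : nmodType) k m (F : m.+1.-tuple nat -> V) :
  \sum_(t <- box k m.+1) F t =
  \sum_(0 <= x < k) \sum_(t <- box k m) F (rcons_tuple t x).
Proof. by rewrite big_allpairs_dep /index_iota subn0. Qed.

Lemma mem_box k m (t : m.-tuple nat) :
  (t \in box k m) = all (fun x => (x < k)%N) t.
Proof.
elim: m t => [|m IHm] t; first by rewrite tuple0 inE eqxx.
have [t' [x ->]] := tuple_rconsP t; rewrite /= all_rcons -IHm.
apply/allpairsPdep/andP.
  case=> [y [u [yk ub /(congr1 val) /= /rcons_inj[tu xy]]]].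
  have -> : t' = u by exact: val_inj.
  by rewrite ub xy; move: yk; rewrite mem_iota.
by case=> xk tb; exists x, t'; rewrite mem_iota.
Qed.

Lemma box_uniq k m : uniq (box k m).
Proof.
elim: m => [//|m IHm] /=; apply: allpairs_uniq; rewrite ?iota_uniq //.
move=> [x t] [y u] _ _ /(congr1 val) /= /rcons_inj[tu ->].
by congr (_, _); exact: val_inj.
Qed.

(** Over a box the sum factors into m geometric sums; a side exceeding every [sumn t] makes the box
    contain the list. *)
Lemma sum_geometric_tuple_le (R : realType) (b : R) m (s : seq (m.-tuple nat)) :
  0 < b < 1 -> uniq s -> \sum_(t <- s) b ^+ sumn t <= (1 - b)^-1 ^+ m.
Proof.
move=> b01 us; have /andP[b0 b1] := b01.
have b0n n : 0 <= b ^+ n by rewrite exprn_ge0 // ltW.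
pose k := (\max_(t <- s) sumn t).+1.
apply: (@le_trans _ _ (\sum_(t <- box k m) b ^+ sumn t)).
  apply: ler_sum_subseq => //; first exact: box_uniq.
  move=> t ts; rewrite mem_box; apply/allP => x xt.
  apply: (@leq_ltn_trans (sumn t)); last by rewrite ltnS; exact: leq_bigmax_seq.
  by rewrite sumnE (big_rem _ xt) leq_addr.
clearbody k; clear us s; elim: m k => [|m IHm] k; first by rewrite big_seq1.
rewrite big_boxS.
under eq_bigr => x _.
  under eq_bigr do rewrite sumn_rcons addnC exprD.
  rewrite -big_distrr /=; over.
rewrite -big_distrl exprS /=; apply: ler_pM => //; rewrite ?sumr_ge0 //.
exact: sum_geometric_le.
Qed.

Section FiniteTerm.
Variables (K : numFieldType) (q : K).
Local Notation p := (q ^+ 2).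

(** Appending [L] to the tuple supplies n_(m+1), so the factor i = m has the same form as the
    others. *)
Definition S_fin_term (m a L : nat) (n : m.-tuple nat) : K :=
  q ^+ (\sum_(1 <= i < m.+1) nth 0%N n i.-1 ^ 2)
  * \prod_(1 <= i < m.+1)
      qbinom p (nth 0%N (rcons n L) i + (a == i)) (nth 0%N n i.-1).

Lemma S_fin_term_rcons m a L (t : m.-tuple nat) x :
  S_fin_term a L (rcons_tuple t x) =
  qbinom p (L + (a == m.+1)) x * q ^+ (x ^ 2) * S_fin_term a x t.
Proof.
rewrite /S_fin_term big_nat_recr // [\prod_(1 <= i < m.+2) _]big_nat_recr //=.
rewrite !nth_rcons !size_rcons !size_tuple ltnn eqxx ltnn eqxx exprD.
have -> : (\sum_(1 <= i < m.+1) nth 0 (rcons t x) i.-1 ^ 2 =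
    \sum_(1 <= i < m.+1) nth 0 t i.-1 ^ 2)%N.
  rewrite !big_nat; apply: eq_bigr => i /andP[i0]; rewrite ltnS => im.
  by rewrite nth_rcons size_tuple prednK // im.
have -> : \prod_(1 <= i < m.+1) qbinom p
      (nth 0%N (rcons (rcons t x) L) i + (a == i)) (nth 0%N (rcons t x) i.-1) =
    \prod_(1 <= i < m.+1) qbinom p
      (nth 0%N (rcons t x) i + (a == i)) (nth 0%N t i.-1).
  rewrite !big_nat; apply: eq_bigr => i /andP[i0]; rewrite ltnS => im.
  rewrite [nth _ (rcons _ L) i]nth_rcons size_rcons size_tuple ltnS im.
  by rewrite [nth _ _ i.-1]nth_rcons size_tuple prednK // im.
by ring.
Qed.

Lemma S_term_rcons m a (t : m.-tuple nat) x :
  S_term q a (rcons_tuple t x) =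
  (qpoch p p x)^-1 * q ^+ (x ^ 2) * S_fin_term a x t.
Proof.
rewrite /S_term /S_fin_term big_nat_recr //=.
rewrite nth_rcons size_tuple ltnn eqxx exprD.
have -> : (\sum_(1 <= i < m.+1) nth 0 (rcons t x) i.-1 ^ 2 =
    \sum_(1 <= i < m.+1) nth 0 t i.-1 ^ 2)%N.
  rewrite !big_nat; apply: eq_bigr => i /andP[i0]; rewrite ltnS => im.
  by rewrite nth_rcons size_tuple prednK // im.
have -> : \prod_(1 <= i < m.+1) qbinom p
      (nth 0%N (rcons t x) i + (a == i)) (nth 0%N (rcons t x) i.-1) =
    \prod_(1 <= i < m.+1) qbinom p
      (nth 0%N (rcons t x) i + (a == i)) (nth 0%N t i.-1).
  rewrite !big_nat; apply: eq_bigr => i /andP[i0]; rewrite ltnS => im.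
  by rewrite [nth _ _ i.-1]nth_rcons size_tuple prednK // im.
by ring.
Qed.

(** In a nonzero term each level exceeds the next outer one by at most the shift, so all entries are
    at most L + m and lie in the box. *)
Lemma sum_box m a L k : (L + m < k)%N ->
  \sum_(t <- box k m) S_fin_term a L t = S_fin q a m L.
Proof.
elim: m L => [|m IHm] L Lk.
  by rewrite big_seq1 /S_fin_term !big_geq // mulr1.
rewrite big_boxS /=.
have aL : (L + (a == m.+1) < k)%N by case: (a == m.+1); lia.
rewrite (big_cat_nat (n := (L + (a == m.+1)).+1)) //=.
rewrite [X in _ + X]big_nat [X in _ + X]big1 ?addr0 => [|x /andP[Lx _]].
  rewrite !big_nat; apply: eq_bigr => x; rewrite ltnS => /andP[_ xL].
  under eq_bigr do rewrite S_fin_term_rcons.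
  rewrite -big_distrr IHm //.
  by move: xL Lk; case: (a == m.+1) => /=; lia.
by rewrite big1 // => t _; rewrite S_fin_term_rcons qbinom_small ?mul0r.
Qed.

End FiniteTerm.

Section TupleLimit.
Variable R : realType.
Local Notation C := (Cnum R).
Variable q : C.
Hypotheses (q0 : q != 0) (q1 : `|q| < 1).
Local Notation p := (q ^+ 2).

Let p0 : p != 0. Proof. exact: expf_neq0. Qed.
Let p1 : `|p| < 1. Proof. by rewrite normrX expr_lt1. Qed.

Lemma S_fin_term_le m a L (t : m.-tuple nat) (c b : R) :
    `|q| = b%:C -> 0 < b < 1 -> 0 < c ->
    (forall n j, `|qbinom p n j| <= c%:C) ->
  `|S_fin_term q a L t| <= (c ^+ m * b ^+ sumn t)%:C.
Proof.
move=> bE /andP[b0 b1] c0 cE; elim: m L t => [|m IHm] L t.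
  rewrite tuple0 /S_fin_term !big_geq // !expr0 !mulr1 normr1.
  by rewrite rmorph1.
have [t' [x ->]] := tuple_rconsP t; rewrite S_fin_term_rcons sumn_rcons.
have -> : c ^+ m.+1 * b ^+ (sumn t' + x) =
    c * b ^+ x * (c ^+ m * b ^+ sumn t') by rewrite exprS exprD; ring.
rewrite !normrM normrX bE [leRHS]rmorphM rmorphM /=.
apply: ler_pM => //; last by rewrite -normrM; exact: IHm.
  by rewrite mulr_ge0 // exprn_ge0 // ler0c ltW.
apply: ler_pM => //; first by rewrite exprn_ge0 // ler0c ltW.
(* Since x <= x^2, the Gaussian factor b^(x^2) is at most b^x. *)
rewrite -rmorphXn lecR; apply: ler_wiXn2l; rewrite ?ltW //.
by case: (x) => // n; rewrite expnS expn1 leq_pmulr.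
Qed.

(** Only the outermost binomial depends on [L], and it tends to 1/(p; p)_(n_m). *)
Lemma S_fin_term_cvg m a (t : m.+1.-tuple nat) :
  (fun L => S_fin_term q a L t) @ \oo --> S_term q a t.
Proof.
have [t' [x ->]] := tuple_rconsP t; rewrite S_term_rcons.
under eq_fun do rewrite S_fin_term_rcons.
apply: cvgM; last exact: cvg_cst.
by apply: cvgM; [exact: cvg_qbinom|exact: cvg_cst].
Qed.

Lemma S_sum_cvg m a : (a <= m.+1)%N ->
  partial_sum (@S_term C q m.+1 a) @ totally -->
  \sum_(0 <= i < a.+1)
    q ^+ i * (theta_prod q m.+1 i * (qpoch_inf (- q) p / qpoch_inf p p)).
Proof.
move=> am; have [b b01 bE] := norm_lt1_complex q0 q1.
have [c c0 cE] := qbinom_bounded p0 p1; have /andP[b0 b1] := b01.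
have M0 (t : m.+1.-tuple nat) : 0 <= c ^+ m.+1 * b ^+ sumn t.
  by rewrite mulr_ge0 ?exprn_ge0 ?ltW.
have Mb (s : seq (m.+1.-tuple nat)) : uniq s ->
    \sum_(t <- s) c ^+ m.+1 * b ^+ sumn t <= c ^+ m.+1 * (1 - b)^-1 ^+ m.+1.
  move=> us; rewrite -big_distrr /=; apply: ler_wpM2l.
    by rewrite exprn_ge0 ?ltW.
  exact: sum_geometric_tuple_le.
(* The side L + m + 2 is the least one that [sum_box] allows for m + 1 variables. *)
apply: (@tannery_totally R _ _ (fun L t => S_fin_term q a L t)
  _ _ (fun L => box (L + m.+1).+1 m.+1) M0 Mb).
- by move=> L t; exact: S_fin_term_le.
- by move=> t; exact: S_fin_term_cvg.
- by move=> L; exact: box_uniq.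
- move=> t; exists (sumn t) => // L tL.
  suff : t \in box (L + m.+1).+1 m.+1 by [].
  have {}tL : (sumn t <= L)%N by exact: tL.
  rewrite mem_box.
  apply/allP => x xt.
  have : (x <= sumn t)%N by rewrite sumnE (big_rem _ xt) leq_addr.
  lia.
- under eq_fun do rewrite sum_box //.
  exact: S_fin_cvg.
Qed.

Lemma S_sumE m a : (a <= m.+1)%N -> S_sum q m.+1 a =
  \sum_(0 <= i < a.+1)
    q ^+ i * (theta_prod q m.+1 i * (qpoch_inf (- q) p / qpoch_inf p p)).
Proof.
by move=> am; apply: cvg_lim; [exact: norm_hausdorff|exact: S_sum_cvg].
Qed.

End TupleLimit.

Theorem theorem1p5 (R : realType) (q : R[i]) (hq0 : 0 < `|q|) (hq1 : `|q| < 1)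
    (m : nat) (hm : (1 <= m)%N) :
  (forall a : nat, (a <= m)%N -> S_converges q m a) /\
  (forall a : nat, (1 <= a <= m)%N ->
    S_sum q m a - S_sum q m (a - 1) =
    q ^+ a * (qpoch_inf (- q) (q ^+ 2) / qpoch_inf (q ^+ 2) (q ^+ 2)) *
      qpoch_infs [:: q ^ (m%:Z + 1 - 2 * a%:Z); q ^+ (m + 3 + 2 * a);
                     q ^+ (2 * m + 4)]
                 (q ^+ (2 * m + 4))).
Proof.
have q0 : q != 0 by rewrite -normr_gt0.
case: m hm => // m _; split=> [a am|[//|a] /andP[_ am]].
  exact: (cvgP _ (@S_sum_cvg R q q0 hq1 m a am)).
rewrite subn1 [in LHS]/=.
rewrite (@S_sumE R q q0 hq1 m a.+1 am) (@S_sumE R q q0 hq1 m a (ltnW am)).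
(* The two sums differ only in their last term, which is the claimed product. *)
rewrite big_nat_recr // [X in X - _]addrC addrK -[RHS]mulrA.
by congr (_ * _); exact: mulrC.
Qed.
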